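(* Let $X, Y$ be Banach spaces over $\mathbb{K}$ and let $T \in \mathcal{N}(X,Y)$ with $T = \sum_{n=1}^\infty \lambda_n x_n^* \otimes y_n$, where $\lambda_n \in \mathbb{R}^+ = (0,\infty)$, $x_n^* \in S_{X^*}$ and $y_n \in S_Y$ for every $n \in \mathbb{N}$. Then the following assertions are equivalent: (1) $\|T\|_N = \sum_{n=1}^\infty \lambda_n$ (in other words, $T$ attains its nuclear norm through the given representation). (2) There is $G \in (\ker J)^\perp$ with $\|G\| = 1$ such that $G(x_n^* )(y_n) = 1$ for every $n \in \mathbb{N}$. (3) For every $G \in (\ker J)^\perp$ with $\|G\| = 1$ and $G(T) = \|T\|_N$, one has $G(x_n^* )(y_n) = 1$ for every $n \in \mathbb{N}$.
   Context: $\mathbb{K}$ is $\mathbb{R}$ or $\mathbb{C}$; $S_Z$ is the unit sphere of $Z$. $X^* \widehat{\otimes}_\pi Y$ is the projective tensor product, the completion of $X^* \otimes Y$ under $\|z\|_\pi = \inf\{\sum_n \|x_n^*\|\|y_n\| : z = \sum_{n=1}^\infty x_n^* \otimes y_n,\ \sum_n \|x_n^*\|\|y_n\| < \infty\}$. The operator $J : X^* \widehat{\otimes}_\pi Y \to \mathcal{L}(X,Y)$ sends $\sum_n x_n^* \otimes y_n$ to the operator $x \mapsto \sum_n x_n^*(x) y_n$. Its range $\mathcal{N}(X,Y)$ is the space of nuclear operators, with the nuclear norm $\|T\|_N = \inf\{\sum_n \|x_n^*\|\|y_n\| : T(x) = \sum_{n=1}^\infty x_n^*(x) y_n \text{ for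 all } x\in X\}$ (infimum over bounded sequences $(x_n^* ) \subseteq X^*$, $(y_n)\subseteq Y$ with $\sum_n\|x_n^*\|\|y_n\|<\infty$); $\mathcal{N}(X,Y)$ is isometrically $X^* \widehat{\otimes}_\pi Y/\ker J$. Here $x^* \otimes y$ also denotes the operator $x\mapsto x^*(x)y$, and the series for $T$ converges in the nuclear norm. The dual $(X^* \widehat{\otimes}_\pi Y)^*$ is identified isometrically with $\mathcal{L}(X^*, Y^* )$ by $G(\sum_n x_n^* \otimes y_n) = \sum_n G(x_n^* )(y_n)$; $(\ker J)^\perp \subseteq \mathcal{L}(X^*,Y^* )$ is the annihilator of $\ker J$, identified isometrically with $\mathcal{N}(X,Y)^*$, and for $G \in (\ker J)^\perp$ one sets $G(T) := G(z)$ for any $z$ with $J(z) = T$. $T\in\mathcal N(X,Y)$ attains its nuclear norm if there is a bounded sequence $(u_n^*, v_n) \subseteq X^* \times Y$ with $\sum_n\|u_n^*\|\|v_n\|<\infty$, $T = \sum_n u_n^* \otimes v_n$ and $\|T\|_N = \sum_n \|u_n^*\|\|v_n\|$. *)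

(* Defs.v *)
From HB Require Import structures.
From mathcomp Require Import all_boot all_order all_algebra.
From mathcomp Require Import complex.
From mathcomp Require Import all_classical all_reals all_analysis.

Set Implicit Arguments.
Unset Strict Implicit.
Unset Printing Implicit Defensive.
Import Order.TTheory GRing.Theory Num.Theory.
Import numFieldNormedType.Exports.
Local Open Scope classical_set_scope.
Local Open Scope ring_scope.

Variant scalar_kind := RealScalars | ComplexScalars.

Definition scalars (R : realType) (k : scalar_kind) : numFieldType :=
  match k with
  | RealScalars => R
  | ComplexScalars => R[i]
  end.

Section Scalars.
Variables (R : realType) (k : scalar_kind).
Local Notation K := (scalars R k).

Definition of_real : R -> K :=
  match k return R -> scalars R k with
  | RealScalars => id
  | ComplexScalars => real_complex R
  end.

Definition real_part : K -> R :=
  match k return scalars R k -> R with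
  | RealScalars => id
  | ComplexScalars => @complex.Re R
  end.

Lemma of_realK : cancel of_real real_part.
Proof. by rewrite /of_real /real_part; case: k. Qed.

Lemma ler_of_real x y : (of_real x <= of_real y) = (x <= y).
Proof. by rewrite /of_real; case: k => //=; rewrite lecR. Qed.

Lemma of_realD x y : of_real (x + y) = of_real x + of_real y.
Proof. by rewrite /of_real; case: k => //=; rewrite rmorphD. Qed.

Lemma of_realM x y : of_real (x * y) = of_real x * of_real y.
Proof. by rewrite /of_real; case: k => //=; rewrite rmorphM. Qed.

Lemma of_real0 : of_real 0 = 0.
Proof. by rewrite /of_real; case: k. Qed.

Lemma of_real1 : of_real 1 = 1.
Proof. by rewrite /of_real; case: k. Qed.

Lemma of_real_ge0 (z : K) : 0 <= z -> of_real (real_part z) = z.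
Proof.
rewrite /of_real /real_part; case: k z => //= z.
by case: z => a b; rewrite lecE/= => /andP[/eqP-> _].
Qed.

End Scalars.

(* The library norm of a normed module over [R[i]] takes its values in [R[i]];
   [rnorm] is the same norm, read in [R]. *)
Definition rnorm (R : realType) (k : scalar_kind)
  (V : normedModType (scalars R k)) (v : V) : R := real_part `|v|.

Section RealNorm.
Variables (R : realType) (k : scalar_kind) (V : normedModType (scalars R k)).
Implicit Types v w : V.

Lemma of_real_rnorm v : of_real k (rnorm v) = `|v|.
Proof. exact: of_real_ge0. Qed.

Lemma rnorm_ge0 v : 0 <= rnorm v.
Proof. by rewrite -(ler_of_real k) of_real_rnorm of_real0. Qed.

Lemma rnorm_ler0 v : rnorm v <= 0 -> v = 0.
Proof.
by rewrite -(ler_of_real k) of_real_rnorm of_real0 normr_le0 => /eqP.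
Qed.

Lemma ler_rnormD v w : rnorm (v + w) <= rnorm v + rnorm w.
Proof. by rewrite -(ler_of_real k) of_realD !of_real_rnorm ler_normD. Qed.

Lemma rnormZ (a : scalars R k) v : rnorm (a *: v) = real_part `|a| * rnorm v.
Proof.
apply: (can_inj (of_realK k)).
by rewrite of_realM !of_real_rnorm of_real_ge0// normrZ.
Qed.

End RealNorm.

Section BoundedOperators.
Variables (R : realType) (k : scalar_kind).
Local Notation K := (scalars R k).
Variables V W : normedModType K.

Definition is_operator : {pred V -> W} :=
  [pred f | `[< linear f /\ continuous f >]].

Record operator := Operator {
  operator_fun :> V -> W ;
  _ : operator_fun \in is_operator }.

HB.instance Definition _ := [isSub for operator_fun].
HB.instance Definition _ := [Choice of operator by <:].

Lemma is_operator_submod : submod_closed is_operator.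
Proof.
split.
  apply/asboolP; split=> [a x y|x]; first by rewrite scaler0 addr0.
  exact: cvg_cst.
move=> a f g /asboolP[lf cf] /asboolP[lg cg]; apply/asboolP; split.
  move=> b x y; rewrite !fctE.
  rewrite lf lg !scalerDr !scalerA (mulrC a b) -!addrA.
  by congr (_ + _); rewrite addrCA.
move=> x; apply: cvgD; last exact: cg.
by apply: cvgZl_tmp; exact: cf.
Qed.

HB.instance Definition _ :=
  GRing.isSubmodClosed.Build K (V -> W) is_operator is_operator_submod.
HB.instance Definition _ := [SubChoice_isSubZmodule of operator by <:].
HB.instance Definition _ := [SubZmodule_isSubLmodule of operator by <:].

Lemma operator_linear (f : operator) : linear f.
Proof. by case: f => f /= /asboolP[]. Qed.

HB.instance Definition _ (f : operator) :=
  GRing.isLinear.Build K V W *:%R f (@operator_linear f).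

Lemma operator_continuous (f : operator) : continuous f.
Proof. by case: f => f /= /asboolP[]. Qed.

Definition opnorm (f : operator) : R :=
  sup [set rnorm (f x) | x in [set x | rnorm x <= 1]].

Lemma opnorm_has_sup (f : operator) :
  has_sup [set rnorm (f x) | x in [set x | rnorm x <= 1]].
Proof.
split; first by exists (rnorm (f 0)), 0 => //=; rewrite /rnorm normr0 -(of_real0 _ k) of_realK.
have /linear_boundedP/pinfty_ex_gt0[r r0 fr] :=
  @continuous_linear_bounded _ _ _ 0 f (@operator_continuous f 0).
exists (real_part r) => _ [x /= x1 <-].
rewrite -(ler_of_real k) of_real_rnorm of_real_ge0 ?(ltW r0)//.
apply: le_trans (fr x) _; rewrite ler_piMr ?(ltW r0)//.
by rewrite -of_real_rnorm -of_real1 ler_of_real.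
Qed.

Lemma opnorm_ub (f : operator) x : rnorm x <= 1 -> rnorm (f x) <= opnorm f.
Proof. by move=> x1; apply: (sup_upper_bound (opnorm_has_sup f)); exists x. Qed.

Lemma opnorm_le (f : operator) M :
  (forall x, rnorm x <= 1 -> rnorm (f x) <= M) -> opnorm f <= M.
Proof.
move=> fM; apply: ge_sup; first by case: (opnorm_has_sup f).
by move=> _ [x /= x1 <-]; exact: fM.
Qed.

Lemma opnorm_ge0 (f : operator) : 0 <= opnorm f.
Proof.
apply: le_trans (rnorm_ge0 _) (@opnorm_ub f 0 _).
by rewrite /rnorm normr0 -(of_real0 _ k) of_realK.
Qed.

Lemma opnormD (f g : operator) : opnorm (f + g) <= opnorm f + opnorm g.
Proof.
apply: opnorm_le => x x1; apply: le_trans (ler_rnormD _ _) _.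
by apply: lerD; exact: opnorm_ub.
Qed.

Lemma opnormZ_le (a : K) (f : operator) :
  opnorm (a *: f) <= real_part `|a| * opnorm f.
Proof.
apply: opnorm_le => x x1; rewrite [X in rnorm X]/= rnormZ.
apply: ler_wpM2l; last exact: opnorm_ub.
by rewrite -(ler_of_real k) of_real0 of_real_ge0.
Qed.

Lemma opnormZ (a : K) (f : operator) :
  opnorm (a *: f) = real_part `|a| * opnorm f.
Proof.
apply/le_anti; rewrite opnormZ_le/=.
have [->|a0] := eqVneq a 0.
  by rewrite normr0 -(of_real0 _ k) of_realK mul0r opnorm_ge0.
have a1 : real_part `|a^-1| * real_part `|a| = 1 :> R.
  apply: (can_inj (of_realK k)).
  by rewrite of_realM !of_real_ge0// -normrM mulVf// normr1 of_real1.
have a'0 : 0 < real_part `|a| :> R.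
  rewrite lt_neqAle -(ler_of_real k) of_real0 of_real_ge0// normr_ge0 andbT.
  by apply/eqP => aE; move: a1; rewrite -aE mulr0 => /eqP; rewrite eq_sym oner_eq0.
rewrite -(ler_pM2l (x := real_part `|a^-1|)); last first.
  by rewrite -(pmulr_lgt0 _ a'0) a1.
rewrite mulrA a1 mul1r.
by have := opnormZ_le a^-1 (a *: f); rewrite scalerA mulVf// scale1r.
Qed.

Lemma opnorm0_eq0 (f : operator) : opnorm f = 0 -> f = 0.
Proof.
move=> f0; apply/val_inj/funext => x /=.
have f1 y : rnorm y <= 1 -> f y = 0.
  by move=> y1; apply: rnorm_ler0; rewrite -f0 opnorm_ub.
have [->|x0] := eqVneq x 0; first by rewrite linear0.
apply: (scalerI (a := `|x|^-1)); first by rewrite invr_eq0 normr_eq0.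
rewrite -linearZ scaler0; apply: f1.
by rewrite -(ler_of_real k) of_real_rnorm normrZV ?unitfE ?normr_eq0// of_real1.
Qed.

Let norm (f : operator) : K := of_real k (opnorm f).

Let ler_normD f g : norm (f + g) <= norm f + norm g.
Proof. by rewrite -of_realD ler_of_real opnormD. Qed.

Let normrZ (a : K) f : norm (a *: f) = `|a| * norm f.
Proof. by rewrite /norm opnormZ of_realM of_real_ge0. Qed.

Let norm0_eq0 f : norm f = 0 -> f = 0.
Proof.
by rewrite -(of_real0 R k) => /(can_inj (of_realK k)); exact: opnorm0_eq0.
Qed.

HB.instance Definition _ :=
  Lmodule_isNormed.Build K operator ler_normD normrZ norm0_eq0.

Lemma rnorm_operator (f : operator) :
  rnorm f = sup [set rnorm (f x) | x in [set x | rnorm x <= 1]].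
Proof. exact: of_realK. Qed.

End BoundedOperators.

Notation "''L' ( X , Y )" := (operator X Y)
  (at level 8, format "''L' ( X ,  Y )") : type_scope.
Notation dual X := (operator X (scalars _ _)^o).

Section RankOne.
Variables (R : realType) (k : scalar_kind).
Variables X Y : normedModType (scalars R k).

Definition rank_one_fun (f : dual X) (y : Y) : X -> Y := fun x => f x *: y.

Lemma rank_one_subproof f y : rank_one_fun f y \in @is_operator R k X Y.
Proof.
apply/asboolP; split=> [a u v|x]; rewrite /rank_one_fun.
  by rewrite linearP scalerDl scalerA.
by apply: cvgZr_tmp; exact: operator_continuous.
Qed.

Definition rank_one (f : dual X) (y : Y) : 'L(X, Y) :=
  Operator (rank_one_subproof f y).

End RankOne.

Section NuclearOperators.
Variables (R : realType) (k : scalar_kind).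
Variables X Y : completeNormedModType (scalars R k).

(* Every element of the completed projective tensor product of [dual X] and [Y]
   is the sum of a series of elementary tensors of finite cost; it is
   represented here by any such series.  Distinct series may represent the same
   tensor, but [J] and the pairing with [G] depend only on the tensor, so that
   [ker_J_perp] is the annihilator of the kernel of [J]. *)
Record tensor_series := TensorSeries {
  tleft : nat -> dual X ;
  tright : nat -> Y ;
  tensor_summable :
    cvgn (series (fun n => rnorm (tleft n) * rnorm (tright n))) }.

Definition tensor_cost (z : tensor_series) : R :=
  limn (series (fun n => rnorm (tleft z n) * rnorm (tright z n))).

(* The series converges absolutely, and [Y] is complete. *)
Definition J (z : tensor_series) : X -> Y :=
  fun x => limn (series (fun n => tleft z n x *: tright z n)).

Definition ker_J : set tensor_series := [set z | J z = cst 0].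

(* The duality between the projective tensor product and ['L(dual X, dual Y)]. *)
Definition pairing (G : 'L(dual X, dual Y)) (z : tensor_series) : scalars R k :=
  limn (series (fun n => G (tleft z n) (tright z n))).

Definition ker_J_perp : set 'L(dual X, dual Y) :=
  [set G | forall z, ker_J z -> pairing G z = 0].

Definition nuclear : set 'L(X, Y) := [set T | exists z, J z = T].

Definition nuclear_norm (T : 'L(X, Y)) : R :=
  inf [set tensor_cost z | z in
    [set z | [/\ bounded_fun (tleft z), bounded_fun (tright z) & J z = T]]].

(* [G(T)], for [T] nuclear: for [G] in [ker_J_perp] the set is a singleton. *)
Definition eval_nuclear (G : 'L(dual X, dual Y)) (T : 'L(X, Y)) : scalars R k :=
  get [set pairing G z | z in [set z | J z = T]].

(* Convergence of a sequence of nuclear operators in the nuclear norm. *)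
Definition nuclear_cvg (S : nat -> 'L(X, Y)) (T : 'L(X, Y)) : Prop :=
  nuclear_norm (T - S n) @[n --> \oo] --> (0 : R).

End NuclearOperators.

(* Main.v *)
Require Import Defs.
From HB Require Import structures.
From mathcomp Require Import all_boot all_order all_algebra.
From mathcomp Require Import complex.
From mathcomp Require Import all_classical all_reals all_analysis.
From mathcomp Require Import lra ring.

Set Implicit Arguments.
Unset Strict Implicit.
Unset Printing Implicit Defensive.
Import Order.TTheory GRing.Theory Num.Theory.
Import numFieldNormedType.Exports.
Local Open Scope classical_set_scope.
Local Open Scope ring_scope.

(** Every operator [G] in [(ker J)^perp] acts on nuclear operators as a linear
    functional [T |-> G(T)] with [|G(T)| <= |G| * N(T)], where [N] is the nuclear
    norm ([eval_nuclearD], [eval_nuclearZ], [eval_nuclear_le]).  Applied to the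
    partial sums of [T = \sum_n lambda_n xs_n (x) y_n], which converge to [T] for
    [N], this continuity gives
      [G(T) = \sum_n lambda_n G(xs_n)(y_n)]    ([eval_nuclear_series_cvg]),
    where the scalars [G(xs_n)(y_n)] have modulus at most [|G| = 1].

    If [N(T) = \sum_n lambda_n] and [G] norms [T], then
    [\sum_n lambda_n (1 - Re G(xs_n)(y_n)) = 0] is a sum of nonnegative terms, so
    [Re G(xs_n)(y_n) = 1], and a scalar of modulus at most 1 with real part 1
    equals 1 ([norming_functional_eq1]): (1) implies (3).

    Some [G] of norm 1 in [(ker J)^perp] does norm [T]
    ([exists_unit_norming_functional]), so (3) implies (2).  It comes from the
    Hahn-Banach theorem in the space of nuclear operators with the seminorm [N]: a
    functional [psi] dominated by [N] defines [G f y = psi (f (x) y)], and the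
    pairing of [G] with a tensor [z] is [psi (J z)] because the partial sums of [z]
    converge to [J z] for [N]; in particular it vanishes on [ker J].

    If [G] has norm 1 and [G(xs_n)(y_n) = 1] for all [n], the displayed formula
    becomes [\sum_n lambda_n = G(T) <= N(T)], and the triangle inequality for [N]
    gives [N(T) <= \sum_n lambda_n] ([attains_of_functional]): (2) implies (1).
    The convergence of [\sum_n lambda_n], which the convergence of the partial sums
    of [T] for [N] does not provide, is a consequence of (2).

    The vector space operations on tensor series are termwise scaling and
    interleaving.  The Hahn-Banach theorem is proved through minimal sublinear
    functionals, which turn out to be linear. *)

(** * Real and complex scalars *)

Section ScalarFacts.
Variables (R : realType) (k : scalar_kind).
Local Notation K := (scalars R k).
Implicit Types (a z : K) (x r : R).

Lemma of_realN x : of_real k (- x) = - of_real k x.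
Proof. by rewrite /of_real; case: k => //=; rewrite rmorphN. Qed.

Lemma of_realB x r : of_real k (x - r) = of_real k x - of_real k r.
Proof. by rewrite of_realD of_realN. Qed.

Lemma of_realV x : of_real k x^-1 = (of_real k x)^-1.
Proof. by rewrite /of_real; case: k => //=; rewrite fmorphV. Qed.

Lemma normr_of_real x : `|of_real k x| = of_real k `|x|.
Proof.
by rewrite /of_real; case: k => //=; rewrite normc_def/= expr0n addr0 sqrtr_sqr.
Qed.

Lemma real_partD z a : real_part (z + a) = real_part z + real_part a.
Proof. by rewrite /real_part; case: k z a => //= -[? ?] [? ?]. Qed.

Lemma real_partN z : real_part (- z) = - real_part z.
Proof. by rewrite /real_part; case: k z => //= -[? ?]. Qed.

Lemma real_part_of_realM x z : real_part (of_real k x * z) = x * real_part z.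
Proof.
by rewrite /real_part /of_real; case: k z => //= -[a b] /=; rewrite mul0r subr0.
Qed.

Lemma real_part_gt0 z : 0 < z -> 0 < real_part z.
Proof.
move=> z0; rewrite lt_def -(ler_of_real k) of_real_ge0 ?of_real0 ltW// andbT.
apply: contraTneq z0 => rz0.
by apply/negP => z0; move: (z0); rewrite -(of_real_ge0 (ltW z0)) rz0 of_real0 ltxx.
Qed.

Lemma real_part_le_norm z : real_part z <= real_part `|z|.
Proof.
rewrite /real_part; case: k z => /= z; first exact: ler_norm.
apply: le_trans (ler_norm _) _.
by have := normc_ge_Re z; rewrite lecE => /andP[].
Qed.

(** Equality in [Re z <= |z|] forces the imaginary part to vanish. *)
Lemma eq_of_real_norm z : `|z| <= of_real k (real_part z) ->
  z = of_real k (real_part z).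
Proof.
rewrite /of_real /real_part; case: k z => //= -[a b].
rewrite normc_def lecR /= => ab.
have a0 : 0 <= a by apply: le_trans ab; exact: sqrtr_ge0.
have : a ^+ 2 + b ^+ 2 <= a ^+ 2.
  by rewrite -(@ler_sqrt _ (a ^+ 2 + b ^+ 2)) ?sqr_ge0// sqrtr_sqr ger0_norm.
rewrite gerDl => b0; have : b ^+ 2 == 0 by rewrite eq_le b0 sqr_ge0.
by rewrite sqrf_eq0 => /eqP ->.
Qed.

End ScalarFacts.

(** * The Hahn-Banach theorem for a seminorm *)

Section HahnBanach.
Variables (R : realType) (k : scalar_kind).
Local Notation K := (scalars R k).
Variable V : lmodType K.
Implicit Types (p q : V -> R) (u v : V) (r t : R).

Definition sublinear q :=
  (forall u v, q (u + v) <= q u + q v) /\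
  (forall r v, 0 < r -> q (of_real k r *: v) <= r * q v).

Lemma sublinear0 q : sublinear q -> q 0 = 0.
Proof.
move=> [qD qZ]; have := qD 0 0; rewrite addr0.
have := qZ 2^-1 0 ltac:(lra); rewrite scaler0; lra.
Qed.

Lemma sublinear_oppr q v : sublinear q -> - q (- v) <= q v.
Proof. by move=> sq; have := sq.1 v (- v); rewrite subrr (sublinear0 sq); lra. Qed.

Lemma sublinearZ q t v : sublinear q -> 0 <= t -> q (of_real k t *: v) = t * q v.
Proof.
move=> sq; rewrite le_eqVlt => /predU1P[<-|t0].
  by rewrite of_real0 scale0r mul0r sublinear0.
apply/le_anti; rewrite sq.2//=.
have := sq.2 t^-1 (of_real k t *: v) ltac:(by rewrite invr_gt0).
rewrite scalerA -of_realM mulVf ?gt_eqF// of_real1 scale1r.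
by rewrite -(ler_pM2l t0) mulrA divff ?gt_eqF// mul1r.
Qed.

(** The largest sublinear functional below [q] whose value at [- x0] is at most
    [- q x0].  A linear functional below it is at least [q x0] at [x0], so it agrees
    with [q] there. *)
Definition tilt q (x0 v : V) : R :=
  inf [set q (v + of_real k t *: x0) - t * q x0 | t in [set t | 0 <= t]].

Section Tilt.
Variables (q : V -> R) (x0 : V).
Hypothesis sq : sublinear q.

Lemma tilt_has_inf v :
  has_inf [set q (v + of_real k t *: x0) - t * q x0 | t in [set t | 0 <= t]].
Proof.
split; first by exists (q (v + of_real k 0 *: x0) - 0 * q x0), 0 => /=.
exists (- q (- v)) => _ [t /= t0 <-].
have := sq.1 (v + of_real k t *: x0) (- v).
by rewrite addrAC subrr add0r sublinearZ//; lra.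
Qed.

Lemma tilt_le t v : 0 <= t -> tilt q x0 v <= q (v + of_real k t *: x0) - t * q x0.
Proof. by move=> t0; apply: (inf_lbound (tilt_has_inf v).2); exists t. Qed.

Lemma le_tilt c v :
  (forall t, 0 <= t -> c <= q (v + of_real k t *: x0) - t * q x0) ->
  c <= tilt q x0 v.
Proof.
move=> cq; apply: lb_le_inf; first exact: (tilt_has_inf v).1.
by move=> _ [t /= t0 <-]; exact: cq.
Qed.

Lemma tilt_sublinear : sublinear (tilt q x0).
Proof.
split=> [u v|r v r0].
  rewrite -lerBlDr; apply: le_tilt => s s0.
  rewrite lerBlDr -lerBlDl; apply: le_tilt => t t0.
  have := tilt_le (u + v) (addr_ge0 s0 t0).
  have := sq.1 (u + of_real k s *: x0) (v + of_real k t *: x0).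
  by rewrite addrACA -scalerDl -of_realD; lra.
rewrite -ler_pdivrMl//; apply: le_tilt => t t0; rewrite ler_pdivrMl//.
have rt : 0 <= r * t by rewrite mulr_ge0// ltW.
have := tilt_le (of_real k r *: v) rt.
by rewrite of_realM -scalerA -scalerDr (sublinearZ _ sq (ltW r0)) mulrBr mulrA.
Qed.

Lemma tilt_le_self v : tilt q x0 v <= q v.
Proof.
by have := tilt_le v (lexx 0); rewrite of_real0 scale0r addr0 mul0r subr0.
Qed.

Lemma tilt_oppr : tilt q x0 (- x0) <= - q x0.
Proof.
have := tilt_le (- x0) ler01.
by rewrite of_real1 scale1r addNr sublinear0// mul1r add0r.
Qed.

End Tilt.

Definition dominated_sublinear p :=
  {q : V -> R | `[< sublinear q /\ forall v, q v <= p v >]}.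

(** Below a sublinear functional the pointwise infimum of a chain of sublinear
    functionals is finite, because [q v >= - q (- v) >= - p (- v)]. *)
Lemma exists_minimal_sublinear p : sublinear p ->
  exists q, [/\ sublinear q, forall v, q v <= p v &
    forall q', sublinear q' -> (forall v, q' v <= q v) -> q' = q].
Proof.
move=> sp; pose D := dominated_sublinear p.
pose Rel (a b : D) := `[< forall v, sval b v <= sval a v >].
have PD (a : D) : sublinear (sval a) /\ forall v, sval a v <= p v.
  by case: a => q /= /asboolP.
have inD q : sublinear q -> (forall v, q v <= p v) -> exists a : D, sval a = q.
  by move=> sq qp; exists (exist (fun _ => is_true _) q (asboolT (conj sq qp))).
have [|a b c /asboolP ab /asboolP bc|a b /asboolP ab /asboolP ba|A totA|m mmin] :=
    @Zorn D Rel.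
- by move=> a; apply/asboolP.
- by apply/asboolP => v; exact: le_trans (bc v) (ab v).
- by apply/val_inj/funext => v; apply/le_anti; rewrite ab ba.
- have [[a0 Aa0]|A0] := pselect (exists a, A a); last first.
    by have [t _] := inD p sp (fun=> lexx _); exists t => s As; case: A0; exists s.
  pose E v := [set sval a v | a in A].
  have infE v : has_inf (E v).
    split; first by exists (sval a0 v), a0.
    exists (- p (- v)) => _ [a _ <-].
    apply: le_trans (sublinear_oppr v (PD a).1).
    by rewrite lerN2; exact: (PD a).2.
  have leE a v : A a -> inf (E v) <= sval a v.
    by move=> Aa; apply: (inf_lbound (infE v).2); exists a.
  have geE c v : (forall a, A a -> c <= sval a v) -> c <= inf (E v).
    by move=> h; apply: lb_le_inf (infE v).1 _ => _ [a Aa <-]; exact: h.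
  have [||t tE] := inD (fun v => inf (E v)); last first.
  - by exists t => s As; apply/asboolP => v; rewrite tE; exact: leE.
  - by move=> v; apply: le_trans (leE a0 v Aa0) _; exact: (PD a0).2.
  - split=> [u v|r v r0] /=.
      rewrite -lerBlDr; apply: (geE) => a Aa.
      rewrite lerBlDr -lerBlDl; apply: (geE) => b Ab; rewrite lerBlDl.
      (* both bounds hold at the smaller of [a] and [b] *)
      have [/asboolP ab|/asboolP ba] := totA _ _ Aa Ab.
        apply: le_trans (leE b _ Ab) _; apply: le_trans ((PD b).1.1 _ _) _.
        by rewrite lerD2r.
      apply: le_trans (leE a _ Aa) _; apply: le_trans ((PD a).1.1 _ _) _.
      by rewrite lerD2l.
    rewrite -ler_pdivrMl//; apply: (geE) => a Aa; rewrite ler_pdivrMl//.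
    by apply: le_trans (leE a _ Aa) _; exact: (PD a).1.2.
- exists (sval m); split; [exact: (PD m).1|exact: (PD m).2|] => q' sq' q'm.
  have [t tq'] := inD q' sq' (fun v => le_trans (q'm v) ((PD m).2 v)).
  rewrite -tq' (mmin t)//; apply/asboolP => v.
  by rewrite tq'.
Qed.

Definition real_linear (f : V -> R) :=
  forall r u v, f (of_real k r *: u + v) = r * f u + f v.

Lemma real_linear_of_odd q : sublinear q -> (forall v, q (- v) = - q v) ->
  real_linear q.
Proof.
move=> sq qN.
have qD u v : q (u + v) = q u + q v.
  apply/le_anti; rewrite sq.1/=.
  by have := sq.1 (- u) (- v); rewrite -opprD !qN; lra.
move=> r u v; rewrite qD; congr (_ + _).
have [r0|r0] := leP 0 r; first by rewrite sublinearZ.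
have r'0 : 0 <= - r by rewrite oppr_ge0 ltW.
by rewrite -{1}[r]opprK of_realN scaleNr qN sublinearZ// mulNr opprK.
Qed.

(** A minimal sublinear functional equals each of its tilts, hence is odd, and an
    odd sublinear functional is linear.  Taking it minimal below [tilt p x0] makes
    it agree with [p] at [x0]. *)
Lemma real_hahn_banach p x0 : sublinear p ->
  exists f, [/\ real_linear f, forall v, f v <= p v & f x0 = p x0].
Proof.
move=> sp.
have [f [sf fp fmin]] := exists_minimal_sublinear (tilt_sublinear x0 sp).
have fN v : f (- v) = - f v.
  apply/le_anti; rewrite [- f v <= _]lerNl sublinear_oppr// andbT.
  have := tilt_oppr v sf.
  by rewrite (fmin _ (tilt_sublinear v sf) (tilt_le_self v sf)).
exists f; split; first exact: real_linear_of_odd.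
  by move=> v; apply: le_trans (fp v) _; exact: tilt_le_self.
apply/le_anti; rewrite (le_trans (fp x0)) ?tilt_le_self//=.
by rewrite -lerN2 -fN (le_trans (fp _)) ?tilt_oppr.
Qed.

(** Over the complex numbers, [f = Re phi] and linearity force
    [Im (phi v) = - f (i v)]. *)
Lemma real_part_extension f : real_linear f ->
  exists phi : V -> K, (forall a u v, phi (a *: u + v) = a * phi u + phi v) /\
    forall v, real_part (phi v) = f v.
Proof.
rewrite /real_linear /of_real /real_part; case: k V f => /= W f fL.
  by exists f.
have fD (u v : W) : f (u + v) = f u + f v.
  by have := fL 1 u v; rewrite scale1r mul1r.
have f0 : f 0 = 0 by have := fD 0 0; rewrite addr0; lra.
have fZ r (u : W) : f ((r%:C)%C *: u) = r * f u.
  by have := fL r u 0; rewrite !addr0 f0 addr0.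
exists (fun v : W => (f v +i* - f ('i *: v))%C); split=> // -[a b] u v.
have uE : (a +i* b)%C *: u = (a%:C)%C *: u + (b%:C)%C *: ('i%C *: u).
  by rewrite scalerA -scalerDl; congr (_ *: _); simpc.
have iuE : 'i%C *: ((a +i* b)%C *: u) = (a%:C)%C *: ('i%C *: u) + ((- b)%:C)%C *: u.
  by rewrite !scalerA -scalerDl; congr (_ *: _); simpc.
rewrite scalerDr iuE uE !fD !fZ.
by simpc; congr (_ +i* _)%C; ring.
Qed.

(** The seminorm of [v] does not change when [v] is rotated, so a bound on the real
    part of [phi] is a bound on its modulus. *)
Lemma hahn_banach p x0 :
  (forall u v, p (u + v) <= p u + p v) ->
  (forall a v, p (a *: v) = real_part `|a| * p v) ->
  exists phi : V -> K,
    [/\ forall a u v, phi (a *: u + v) = a * phi u + phi v,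
        forall v, `|phi v| <= of_real k (p v) & phi x0 = of_real k (p x0)].
Proof.
move=> pD pZ.
have sp : sublinear p.
  split=> // r v r0; rewrite pZ normr_of_real of_realK.
  by rewrite (ger0_norm (ltW r0)).
have [f [fL fp fx0]] := real_hahn_banach x0 sp.
have [phi [phiL phif]] := real_part_extension fL.
have phiZ a v : phi (a *: v) = a * phi v.
  have phi0 : phi 0 = 0.
    by have := phiL (-1) 0 0; rewrite scaler0 addr0 mulN1r addNr.
  by have := phiL a v 0; rewrite !addr0 phi0 addr0.
have phip v : `|phi v| <= of_real k (p v).
  have [->|z0] := eqVneq (phi v) 0.
    rewrite normr0 -(of_real0 _ k) ler_of_real.
    by have := sublinear_oppr v sp; rewrite -scaleN1r pZ normrN1 -of_real1 of_realK; lra.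
  (* rotate [phi v] onto the positive half-line *)
  pose a := `|phi v| / phi v.
  have a1 : `|a| = 1 by rewrite normrM normr_id normfV divff// normr_eq0.
  rewrite -[`|phi v|]of_real_ge0// ler_of_real.
  have -> : `|phi v| = phi (a *: v) by rewrite phiZ divfK.
  rewrite phif; apply: le_trans (fp _) _.
  by rewrite pZ a1 -of_real1 of_realK mul1r.
exists phi; split=> //.
have := phip x0; rewrite -fx0 -phif; exact: eq_of_real_norm.
Qed.

End HahnBanach.

(** * Convergence and the real-valued norm *)

Section RealNormFacts.
Variables (R : realType) (k : scalar_kind).
Local Notation K := (scalars R k).
Variable V : normedModType K.
Implicit Types (u v w : V) (r : R) (a : K).

Lemma rnorm0 : rnorm (0 : V) = 0.
Proof. by rewrite /rnorm normr0 -(of_real0 _ k) of_realK. Qed.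

Lemma rnorm_of_realZ r v : rnorm (of_real k r *: v) = `|r| * rnorm v.
Proof. by rewrite rnormZ normr_of_real of_realK. Qed.

Lemma rnorm_gt0 v : v != 0 -> 0 < rnorm v.
Proof.
rewrite lt_def rnorm_ge0 andbT; apply: contra_neq => v0.
by apply: rnorm_ler0; rewrite v0.
Qed.

Lemma ler_rnorm_sum (u_ : nat -> V) n :
  rnorm (series u_ n) <= series (fun i => rnorm (u_ i)) n.
Proof.
elim: n => [|n IHn]; first by rewrite !seriesEnat/= !big_geq// rnorm0.
by rewrite !seriesSr; apply: le_trans (ler_rnormD _ _) _; rewrite lerD2r.
Qed.

Lemma cvg_rnormP (u_ : nat -> V) l :
  (u_ @ \oo --> l) <-> (rnorm (l - u_ n) @[n --> \oo] --> (0 : R)).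
Proof.
split=> [/cvgrPdist_le ul|/cvgrPdist_le ul].
  apply/cvgrPdist_le => e e0.
  have e'0 : 0 < of_real k e.
    rewrite lt_def -(of_real0 _ k) ler_of_real ltW// andbT.
    by rewrite (can_eq (of_realK k)) gt_eqF.
  near=> n; rewrite sub0r normrN ger0_norm ?rnorm_ge0//.
  rewrite -(ler_of_real k) of_real_rnorm.
  by near: n; exact: ul.
apply/cvgrPdist_le => e e0.
have eE : of_real k (real_part e) = e by rewrite of_real_ge0// ltW.
have := ul _ (real_part_gt0 e0); apply: filterS => n.
by rewrite sub0r normrN ger0_norm ?rnorm_ge0// -(ler_of_real k) of_real_rnorm eE.
Unshelve. all: by end_near. Qed.

Lemma cvg_rnorm_le (u_ : nat -> V) (a_ : nat -> R) l :
  (forall n, rnorm (l - u_ n) <= a_ n) -> a_ @ \oo --> (0 : R) ->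
  u_ @ \oo --> l.
Proof.
move=> ua a0; apply/cvg_rnormP.
apply: (squeeze_cvgr _ (cvg_cst 0) a0).
by near=> n; rewrite rnorm_ge0 ua.
Unshelve. all: by end_near. Qed.

Lemma rnorm_lim_le (u_ : nat -> V) l r :
  u_ @ \oo --> l -> (forall n, rnorm (u_ n) <= r) -> rnorm l <= r.
Proof.
move=> /cvg_rnormP ul ur; rewrite -subr_le0.
apply: (cvgr_to_ge ul); near=> n.
have := ler_rnormD (l - u_ n) (u_ n); rewrite subrK.
by have := ur n; lra.
Unshelve. all: by end_near. Qed.

End RealNormFacts.

Section Scalar.
Variables (R : realType) (k : scalar_kind).
Local Notation K := (scalars R k).

Lemma rnorm_scalar (z : K) : rnorm (z : K^o) = real_part `|z|.
Proof. by []. Qed.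

Lemma cvg_of_realP (u_ : nat -> R) (l : R) :
  (of_real k (u_ n) @[n --> \oo] --> of_real k l) <-> (u_ @ \oo --> l).
Proof.
have E n : rnorm (of_real k l - of_real k (u_ n) : K^o) = `|l - u_ n|.
  by rewrite rnorm_scalar -of_realB normr_of_real of_realK.
split=> ul.
  apply/cvgrPdist_le => e e0.
  move/(@cvg_rnormP _ _ (K^o)): ul => /cvgrPdist_le/(_ e e0).
  by apply: filterS => n; rewrite E sub0r normrN normr_id.
apply/(@cvg_rnormP _ _ (K^o)); under eq_fun do rewrite E.
apply/cvgrPdist_le => e e0; move/cvgrPdist_le: ul => /(_ e e0).
by apply: filterS => n; rewrite sub0r normrN normr_id.
Qed.

Lemma cvg_real_part (u_ : nat -> K) (l : K) :
  u_ @ \oo --> l -> real_part (u_ n) @[n --> \oo] --> real_part l.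
Proof.
move=> /(@cvg_rnormP _ _ (K^o)) ul.
have dE n : `|real_part l - real_part (u_ n)| <= rnorm (l - u_ n : K^o).
  rewrite ler_norml rnorm_scalar -real_partN -real_partD real_part_le_norm andbT.
  by rewrite lerNl -real_partN -normrN real_part_le_norm.
apply/cvgrPdist_le => e e0; move/cvgrPdist_le: ul => /(_ e e0).
apply: filterS => n; rewrite sub0r normrN ger0_norm ?rnorm_ge0//.
exact: le_trans.
Qed.

End Scalar.

(** The real and imaginary parts converge absolutely, being dominated by the
    modulus. *)
Lemma scalar_abs_cvg (R : realType) (k : scalar_kind)
    (u_ : nat -> scalars R k) :
  cvgn (series (fun n => real_part `|u_ n|)) -> cvgn (series u_).
Proof.
have Re_cvg (a_ : nat -> R) (b_ : nat -> R) : (forall n, `|a_ n| <= b_ n) ->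
    cvgn (series b_) -> cvgn (series a_).
  move=> ab cb; apply: (@normed_cvg R R^o).
  apply: series_le_cvg cb => n /=; [exact: normr_ge0| |exact: ab].
  exact: le_trans (normr_ge0 _) (ab n).
rewrite /real_part; case: k u_ => u_; first exact: Re_cvg.
move=> cu.
have normE (z : R[i]) :
    complex.Re `|z| = Num.sqrt (complex.Re z ^+ 2 + complex.Im z ^+ 2).
  by rewrite normc_def.
have cRe : cvgn (series (fun n => complex.Re (u_ n))).
  apply: Re_cvg cu => n; rewrite normE -sqrtr_sqr ler_wsqrtr//.
  by rewrite lerDl sqr_ge0.
have cIm : cvgn (series (fun n => complex.Im (u_ n))).
  apply: Re_cvg cu => n; rewrite normE -sqrtr_sqr ler_wsqrtr//.
  by rewrite lerDr sqr_ge0.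
have uE n : series u_ n =
    of_real ComplexScalars (series (fun n => complex.Re (u_ n)) n) +
    of_real ComplexScalars (series (fun n => complex.Im (u_ n)) n) * 'i%C.
  elim: n => [|n IHn].
    by rewrite !seriesEnat/= !big_geq//= mul0r addr0.
  rewrite !seriesSr IHn !of_realD mulrDl addrACA; congr (_ + _).
  by case: (u_ n) => a b /=; simpc.
have cvg_of_real (a_ : nat -> R) : cvgn a_ ->
    cvgn (fun n => of_real ComplexScalars (a_ n)).
  move=> ca; apply/cvg_ex; exists (of_real ComplexScalars (limn a_)).
  exact: (proj2 (cvg_of_realP ComplexScalars a_ _) ca).
rewrite (funext uE); apply: is_cvgD; first exact: cvg_of_real.
by apply: is_cvgMl; exact: cvg_of_real.
Qed.

(** * Absolutely convergent and interleaved series *)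

Section AbsoluteConvergence.
Variables (R : realType) (k : scalar_kind).
Local Notation K := (scalars R k).

(** Isolated as a property so that operator values in [Y] and scalar pairings are
    summed by the same lemmas. *)
Definition abs_complete (W : normedModType K) :=
  forall u_ : nat -> W, cvgn (series (fun n => rnorm (u_ n))) ->
    cvgn (series u_).

Lemma abs_complete_scalars : abs_complete (K^o : normedModType K).
Proof. exact: scalar_abs_cvg. Qed.

Lemma abs_complete_banach (V : completeNormedModType K) : abs_complete V.
Proof.
move=> u_ /cauchy_cvgP/(@cauchy_seriesP R R^o) cu.
apply/cauchy_cvgP/cauchy_seriesP => e e0.
have eE : of_real k (real_part e) = e by rewrite of_real_ge0// ltW.
have := cu _ (real_part_gt0 e0); apply: filterS => n.
rewrite ger0_norm; last by apply: sumr_ge0 => i _; exact: rnorm_ge0.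
move=> sum_lt; apply: le_lt_trans (ler_norm_sum _ _ _) _.
under eq_bigr do rewrite -of_real_rnorm.
rewrite -(big_morph (of_real k) (@of_realD R k) (of_real0 R k)) -eE lt_def.
by rewrite ler_of_real (ltW sum_lt) andbT (can_eq (of_realK k)) gt_eqF.
Qed.

End AbsoluteConvergence.

Section Interleave.

Definition interleave T (u_ v_ : nat -> T) n :=
  if odd n then v_ n./2 else u_ n./2.

Lemma interleave_map2 T1 T2 T (f : T1 -> T2 -> T) u_ v_ u'_ v'_ :
  (fun n => f (interleave u_ v_ n) (interleave u'_ v'_ n)) =
  interleave (fun n => f (u_ n) (u'_ n)) (fun n => f (v_ n) (v'_ n)).
Proof. by apply/funext => n; rewrite /interleave; case: odd. Qed.

Lemma series_interleave_double (V : zmodType) (u_ v_ : nat -> V) n :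
  series (interleave u_ v_) n.*2 = series u_ n + series v_ n.
Proof.
elim: n => [|n IHn]; first by rewrite !seriesEnat/= !big_geq// addr0.
rewrite doubleS !seriesSr IHn -addrA addrACA; congr (_ + (_ + _)).
  by rewrite /interleave odd_double doubleK.
by rewrite /interleave /= odd_double/= uphalf_double.
Qed.

Lemma cvg_double (T : topologicalType) (u_ : nat -> T) (l : T) :
  u_ @ \oo --> l -> u_ n.*2 @[n --> \oo] --> l.
Proof.
move=> ul; apply: (cvg_comp (fun n => n.*2) u_) ul.
move=> A [N _ NA]; exists N => // n /= Nn; apply: NA => /=.
by rewrite (leq_trans Nn)// -addnn leq_addr.
Qed.

(** The partial sums of even length are sums of partial sums of both series. *)
Lemma cvg_series_interleave (K : numFieldType) (V : normedModType K)
    (u_ v_ : nat -> V) l m :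
  cvgn (series (interleave u_ v_)) ->
  series u_ @ \oo --> l -> series v_ @ \oo --> m ->
  series (interleave u_ v_) @ \oo --> l + m.
Proof.
move=> cw ul vm; have /cvg_double := cw.
under eq_fun do rewrite series_interleave_double.
have lm : series u_ n + series v_ n @[n --> \oo] --> l + m by exact: cvgD.
by move=> /(cvg_unique (@norm_hausdorff _ _) lm) ->.
Qed.

Lemma is_cvg_series_interleave (R : realType) (a_ b_ : nat -> R) :
  (forall n, 0 <= a_ n) -> (forall n, 0 <= b_ n) ->
  cvgn (series a_) -> cvgn (series b_) -> cvgn (series (interleave a_ b_)).
Proof.
move=> a0 b0 ca cb.
have w0 n : 0 <= interleave a_ b_ n by rewrite /interleave; case: odd.
have nds (u_ : nat -> R) : (forall n, 0 <= u_ n) -> nondecreasing_seq (series u_).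
  by move=> u0; apply: nondecreasing_series => n _ _; exact: u0.
apply: nondecreasing_is_cvgn; first exact: nds.
exists (limn (series a_) + limn (series b_)) => _ [n _ <-].
apply: (@le_trans _ _ (series (interleave a_ b_) n.*2)).
  by apply: nds => //; rewrite -addnn leq_addr.
by rewrite series_interleave_double lerD// nondecreasing_cvgn_le//; exact: nds.
Qed.

End Interleave.

Section OperatorBounds.
Variables (R : realType) (k : scalar_kind).
Local Notation K := (scalars R k).
Variables V W : normedModType K.

Lemma rnorm_operator_le (f : 'L(V, W)) x : rnorm (f x) <= rnorm f * rnorm x.
Proof.
have -> : rnorm f = opnorm f by exact: of_realK.
have [->|x0] := eqVneq x 0; first by rewrite linear0 !rnorm0 mulr0.
have nx0 := rnorm_gt0 x0.
have := @opnorm_ub _ _ _ _ f (of_real k (rnorm x)^-1 *: x).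
rewrite linearZ !rnorm_of_realZ ger0_norm ?invr_ge0 ?rnorm_ge0//.
by rewrite mulVf ?gt_eqF// ler_pdivrMl// mulrC; exact.
Qed.

Lemma rnorm_operator_ub (f : 'L(V, W)) c :
  0 <= c -> (forall x, rnorm (f x) <= c * rnorm x) -> rnorm f <= c.
Proof.
move=> c0 fc; have -> : rnorm f = opnorm f by exact: of_realK.
by apply: opnorm_le => x x1; apply: le_trans (fc x) _; rewrite ler_piMr.
Qed.

Lemma is_operator_bounded (f : V -> W) c :
  linear f -> (forall x, rnorm (f x) <= c * rnorm x) -> f \in @is_operator R k V W.
Proof.
move=> fL fc; apply/asboolP; split=> //.
pose F : {linear V -> W} := HB.pack f (GRing.isLinear.Build K V W *:%R f fL).
apply: (proj1 (linear_bounded_continuous F)); apply/linear_boundedP.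
near=> r => x; apply: (@le_trans _ _ (of_real k c * `|x|)).
  by rewrite -!of_real_rnorm -of_realM ler_of_real; exact: fc.
apply: ler_wpM2r => //; near: r.
by apply: nbhs_pinfty_ge; rewrite realE -(of_real0 _ k) !ler_of_real -realE num_real.
Unshelve. all: by end_near. Qed.

End OperatorBounds.

(** * Operations on tensor series *)

Section TensorOperations.
Variables (R : realType) (k : scalar_kind).
Local Notation K := (scalars R k).
Variables X Y : completeNormedModType K.
Implicit Types z : tensor_series X Y.

Let term_cost z n := rnorm (tleft z n) * rnorm (tright z n).

Let term_cost_ge0 z n : 0 <= term_cost z n.
Proof. by rewrite mulr_ge0 ?rnorm_ge0. Qed.

Lemma tensor_cost_cvg z :
  series (fun n => rnorm (tleft z n) * rnorm (tright z n)) @ \oo -->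
  tensor_cost z.
Proof. exact: tensor_summable. Qed.

Lemma tensor_cost_ge_partial z N :
  series (fun n => rnorm (tleft z n) * rnorm (tright z n)) N <= tensor_cost z.
Proof.
apply: nondecreasing_cvgn_le; last exact: tensor_summable.
by apply: nondecreasing_series => n _ _; exact: term_cost_ge0.
Qed.

Lemma tensor_cost_ge0 z : 0 <= tensor_cost z.
Proof.
apply: le_trans (tensor_cost_ge_partial z 0).
by rewrite seriesEnat/= big_geq.
Qed.

Fact tensor_add_summable z1 z2 :
  cvgn (series (fun n => rnorm (interleave (tleft z1) (tleft z2) n) *
                         rnorm (interleave (tright z1) (tright z2) n))).
Proof.
rewrite (interleave_map2 (fun f y => rnorm f * rnorm y)).
apply: is_cvg_series_interleave; try exact: term_cost_ge0;
  exact: tensor_summable.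
Qed.

(** Interleaving represents the sum of two tensors by a single series. *)
Definition tensor_add z1 z2 := TensorSeries (@tensor_add_summable z1 z2).

Fact tensor_scale_summable (a : K) z :
  cvgn (series (fun n => rnorm (a *: tleft z n) * rnorm (tright z n))).
Proof.
rewrite (_ : (fun n => _) = real_part `|a| *: (term_cost z : nat -> R^o)); last first.
  by apply/funext => n; rewrite rnormZ -mulrA.
by apply: is_cvg_seriesZ; exact: tensor_summable.
Qed.

Definition tensor_scale a z := TensorSeries (@tensor_scale_summable a z).

Lemma series_shift (V : zmodType) (u_ : nat -> V) N n :
  series (fun i => u_ (i + N)%N) n = series u_ (n + N)%N - series u_ N.
Proof.
elim: n => [|n IHn]; first by rewrite add0n subrr seriesEnat/= big_geq.
by rewrite addSn !seriesSr IHn addrAC.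
Qed.

Lemma cvg_series_shift (F : numFieldType) (V : normedModType F) (u_ : nat -> V) N l :
  series u_ @ \oo --> l ->
  series (fun i => u_ (i + N)%N) @ \oo --> l - series u_ N.
Proof.
move=> ul; rewrite (funext (series_shift u_ N)).
apply: cvgB; last exact: cvg_cst.
by rewrite (cvg_shiftn N (series u_)).
Qed.

Fact tensor_shift_summable N z :
  cvgn (series (fun n => rnorm (tleft z (n + N)%N) * rnorm (tright z (n + N)%N))).
Proof.
apply/cvg_ex; eexists; apply: (@cvg_series_shift R R^o (term_cost z)).
exact: tensor_cost_cvg.
Qed.

Definition tensor_shift N z := TensorSeries (@tensor_shift_summable N z).

Lemma cvg_series_head (F : numFieldType) (V : normedModType F) (u_ : nat -> V) :
  (forall n, u_ n.+1 = 0) -> series u_ @ \oo --> u_ 0%N.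
Proof.
move=> u0; rewrite -(cvg_shiftS (series u_)).
rewrite (_ : [sequence _]_n = cst (u_ 0%N)); first exact: cvg_cst.
apply/funext; elim=> [|n IHn] /=.
  by rewrite seriesSr seriesEnat/= big_geq// add0r.
by rewrite seriesSr u0 addr0.
Qed.

Definition single_left (f : dual X) n : dual X := if n is 0%N then f else 0.

Fact tensor_single_summable f (y : Y) :
  cvgn (series (fun n => rnorm (single_left f n) * rnorm y)).
Proof.
apply/cvg_ex; exists (rnorm f * rnorm y).
apply: (@cvg_series_head R R^o (fun n => rnorm (single_left f n) * rnorm y)).
by move=> n; rewrite /= rnorm0 mul0r.
Qed.

Definition tensor_single f y := TensorSeries (@tensor_single_summable f y).

Definition unit_left z n : dual X :=
  of_real k (rnorm (tleft z n))^-1 *: tleft z n.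
Definition weighted_right z n : Y := of_real k (rnorm (tleft z n)) *: tright z n.

Lemma term_cost_normalize z n :
  rnorm (unit_left z n) * rnorm (weighted_right z n) = term_cost z n.
Proof.
rewrite /term_cost !rnorm_of_realZ normfV ger0_norm ?rnorm_ge0//.
have [->|f0] := eqVneq (tleft z n) 0; first by rewrite rnorm0 mulr0 !mul0r.
by rewrite mulVf ?mul1r// gt_eqF// rnorm_gt0.
Qed.

Fact tensor_normalize_summable z :
  cvgn (series (fun n => rnorm (unit_left z n) * rnorm (weighted_right z n))).
Proof. by under eq_fun do rewrite term_cost_normalize; exact: tensor_summable. Qed.

(** The same tensor, with its factors rescaled so that both sequences are
    bounded; the infimum defining the nuclear norm is over such series. *)
Definition tensor_normalize z := TensorSeries (@tensor_normalize_summable z).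

Lemma bounded_fun_rnorm (V : normedModType K) (u_ : nat -> V) c :
  (forall n, rnorm (u_ n) <= c) -> bounded_fun u_.
Proof.
move=> uc; have cE : of_real k c \is Num.real.
  by rewrite realE -(of_real0 _ k) !ler_of_real -realE num_real.
have := nbhs_pinfty_ge cE; apply: filterS => M cM n _.
by apply: le_trans cM; rewrite -of_real_rnorm ler_of_real.
Qed.

Lemma tensor_normalize_bounded z :
  bounded_fun (tleft (tensor_normalize z)) /\
  bounded_fun (tright (tensor_normalize z)).
Proof.
split.
  apply: (@bounded_fun_rnorm _ _ 1) => n.
  rewrite rnorm_of_realZ normfV ger0_norm ?rnorm_ge0//.
  have [->|f0] := eqVneq (tleft z n) 0; first by rewrite rnorm0 mulr0.
  by rewrite mulVf// gt_eqF// rnorm_gt0.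
apply: (@bounded_fun_rnorm _ _ (tensor_cost z)) => n.
rewrite rnorm_of_realZ ger0_norm ?rnorm_ge0//.
apply: le_trans (tensor_cost_ge_partial z n.+1).
rewrite seriesSr lerDr seriesEnat /=.
by apply: sumr_ge0 => i _; exact: term_cost_ge0.
Qed.

Lemma tensor_cost_normalize z : tensor_cost (tensor_normalize z) = tensor_cost z.
Proof.
rewrite /tensor_cost; congr (limn (series _)); apply/funext => n.
exact: term_cost_normalize.
Qed.

Lemma tensor_cost_add z1 z2 :
  tensor_cost (tensor_add z1 z2) = tensor_cost z1 + tensor_cost z2.
Proof.
apply: cvg_lim; first exact: (@norm_hausdorff R R^o).
rewrite (interleave_map2 (fun f y => rnorm f * rnorm y)).
apply: (@cvg_series_interleave R R^o); [|exact: tensor_cost_cvg..].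
rewrite -(interleave_map2 (fun f y => rnorm f * rnorm y)).
exact: tensor_add_summable.
Qed.

Lemma tensor_cost_scale a z :
  tensor_cost (tensor_scale a z) = real_part `|a| * tensor_cost z.
Proof.
rewrite /tensor_cost /=.
rewrite (_ : (fun n => _) = real_part `|a| *: (term_cost z : nat -> R^o)); last first.
  by apply/funext => n; rewrite rnormZ -mulrA.
by rewrite lim_seriesZ//; exact: tensor_summable.
Qed.

Lemma tensor_cost_shift N z : tensor_cost (tensor_shift N z) =
  tensor_cost z - series (fun n => rnorm (tleft z n) * rnorm (tright z n)) N.
Proof.
apply: cvg_lim; first exact: (@norm_hausdorff R R^o).
apply: (@cvg_series_shift R R^o (term_cost z)); exact: tensor_cost_cvg.
Qed.

Lemma tensor_cost_single f y : tensor_cost (tensor_single f y) = rnorm f * rnorm y.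
Proof.
apply: cvg_lim; first exact: (@norm_hausdorff R R^o).
apply: (@cvg_series_head R R^o (fun n => rnorm (single_left f n) * rnorm y)).
by move=> n; rewrite /= rnorm0 mul0r.
Qed.

End TensorOperations.

(** A bounded map [B], homogeneous in each variable, can be summed along a tensor
    series.  This covers both the evaluations [z |-> J z x] and the pairing. *)
Section TensorSums.
Variables (R : realType) (k : scalar_kind).
Local Notation K := (scalars R k).
Variables (X Y : completeNormedModType K) (W : normedModType K).
Variables (B : dual X -> Y -> W) (c : R).
Implicit Types z : tensor_series X Y.
Hypothesis W_complete : abs_complete W.
Hypothesis B_bounded : forall f y, rnorm (B f y) <= c * (rnorm f * rnorm y).
Hypothesis B_Zl : forall a f y, B (a *: f) y = a *: B f y.
Hypothesis B_Zr : forall a f y, B f (a *: y) = a *: B f y.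

Definition tensor_sum z : W := limn (series (fun n => B (tleft z n) (tright z n))).

Lemma tensor_sum_is_cvg z : cvgn (series (fun n => B (tleft z n) (tright z n))).
Proof.
apply: W_complete.
apply: (@series_le_cvg _ _ (fun n => c * (rnorm (tleft z n) * rnorm (tright z n)))).
- by move=> n; exact: rnorm_ge0.
- by move=> n; exact: le_trans (rnorm_ge0 _) (B_bounded (tleft z n) (tright z n)).
- by move=> n; exact: B_bounded.
apply: (@is_cvg_seriesZ R (fun n => rnorm (tleft z n) * rnorm (tright z n))).
exact: tensor_summable.
Qed.

Lemma tensor_sum_cvg z :
  series (fun n => B (tleft z n) (tright z n)) @ \oo --> tensor_sum z.
Proof. exact: tensor_sum_is_cvg. Qed.

Lemma tensor_sum_unique z w :
  series (fun n => B (tleft z n) (tright z n)) @ \oo --> w -> tensor_sum z = w.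
Proof. by apply: cvg_lim; exact: norm_hausdorff. Qed.

Lemma tensor_sum_le z : 0 <= c -> rnorm (tensor_sum z) <= c * tensor_cost z.
Proof.
move=> c0; apply: (rnorm_lim_le (@tensor_sum_cvg z)) => n.
apply: le_trans (ler_rnorm_sum _ _) _.
apply: le_trans (ler_wpM2l c0 (tensor_cost_ge_partial z n)).
rewrite !seriesEnat /= mulr_sumr; apply: ler_sum => i _; exact: B_bounded.
Qed.

Lemma tensor_sum_add z1 z2 :
  tensor_sum (tensor_add z1 z2) = tensor_sum z1 + tensor_sum z2.
Proof.
apply: tensor_sum_unique => /=; rewrite interleave_map2.
apply: cvg_series_interleave; [|exact: tensor_sum_cvg..].
by rewrite -interleave_map2; exact: (@tensor_sum_is_cvg (tensor_add z1 z2)).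
Qed.

Lemma tensor_sum_scale a z : tensor_sum (tensor_scale a z) = a *: tensor_sum z.
Proof.
apply: tensor_sum_unique => /=; under eq_fun do rewrite B_Zl.
rewrite (_ : series _ = fun n => a *: series (fun n => B (tleft z n) (tright z n)) n).
  by apply: cvgZl_tmp; exact: tensor_sum_cvg.
by apply/funext => n; rewrite !seriesEnat /= scaler_sumr.
Qed.

Lemma tensor_sum_shift N z : tensor_sum (tensor_shift N z) =
  tensor_sum z - series (fun n => B (tleft z n) (tright z n)) N.
Proof.
apply: tensor_sum_unique.
apply: (cvg_series_shift (u_ := fun n => B (tleft z n) (tright z n))).
exact: tensor_sum_cvg.
Qed.

Let B0 y : B 0 y = 0.
Proof. by have := B_Zl 0 0 y; rewrite !scale0r. Qed.

Lemma tensor_sum_single f y : tensor_sum (tensor_single f y) = B f y.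
Proof.
apply: tensor_sum_unique.
by apply: (cvg_series_head (u_ := fun n => B (single_left f n) y)) => n /=.
Qed.

Lemma tensor_sum_normalize z : tensor_sum (tensor_normalize z) = tensor_sum z.
Proof.
rewrite /tensor_sum; congr (limn (series _)); apply/funext => n /=.
rewrite /unit_left /weighted_right B_Zl B_Zr scalerA -of_realM.
have [->|f0] := eqVneq (tleft z n) 0; first by rewrite B0 scaler0.
by rewrite mulVf ?of_real1 ?scale1r// gt_eqF// rnorm_gt0.
Qed.

End TensorSums.

(** * The nuclear norm *)

Section NuclearNorm.
Variables (R : realType) (k : scalar_kind).
Local Notation K := (scalars R k).
Variables X Y : completeNormedModType K.
Implicit Types (z : tensor_series X Y) (S T : 'L(X, Y)) (f : dual X) (y : Y).

Let eval_term (x : X) f y : Y := f x *: y.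

Let eval_bounded x f y : rnorm (eval_term x f y) <= rnorm x * (rnorm f * rnorm y).
Proof.
rewrite rnormZ mulrA [rnorm x * _]mulrC ler_wpM2r ?rnorm_ge0//.
exact: (rnorm_operator_le f x).
Qed.

Let eval_Zl x a f y : eval_term x (a *: f) y = a *: eval_term x f y.
Proof. by rewrite /eval_term scalerA. Qed.

Let eval_Zr x a f y : eval_term x f (a *: y) = a *: eval_term x f y.
Proof. by rewrite /eval_term !scalerA mulrC. Qed.

Lemma rnorm_J_le z x : rnorm (J z x) <= rnorm x * tensor_cost z.
Proof.
exact: (tensor_sum_le (@abs_complete_banach _ _ Y) (@eval_bounded x) z (rnorm_ge0 x)).
Qed.

Lemma J_add z1 z2 x : J (tensor_add z1 z2) x = J z1 x + J z2 x.
Proof. exact: (tensor_sum_add (@abs_complete_banach _ _ Y) (@eval_bounded x)). Qed.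

Lemma J_scale a z x : J (tensor_scale a z) x = a *: J z x.
Proof.
exact: (tensor_sum_scale (@abs_complete_banach _ _ Y) (@eval_bounded x) (@eval_Zl x)).
Qed.

Lemma J_shift N z x : J (tensor_shift N z) x =
  J z x - series (fun n => rank_one (tleft z n) (tright z n)) N x.
Proof.
rewrite [LHS](tensor_sum_shift (@abs_complete_banach _ _ Y) (@eval_bounded x)).
congr (_ - _); elim: N => [|N IHN]; first by rewrite !seriesEnat/= !big_geq.
by rewrite !seriesSr IHN.
Qed.

Lemma J_single f y : J (tensor_single f y) = rank_one f y.
Proof.
by apply/funext => x; exact: (tensor_sum_single (@eval_Zl x)).
Qed.

Lemma J_normalize z : J (tensor_normalize z) = J z.
Proof.
by apply/funext => x; exact: (tensor_sum_normalize (@eval_Zl x) (@eval_Zr x)).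
Qed.

(** The infimum may be taken over all tensor series representing [T]: normalizing
    a series makes its factors bounded and keeps its cost. *)
Lemma nuclear_norm_le z T : J z = T -> nuclear_norm T <= tensor_cost z.
Proof.
move=> zT; rewrite -tensor_cost_normalize; apply: ge_inf.
  by exists 0 => _ [z' _ <-]; exact: tensor_cost_ge0.
have [bl br] := tensor_normalize_bounded z.
by exists (tensor_normalize z); rewrite //=; split=> //; rewrite J_normalize.
Qed.

Lemma le_nuclear_norm T c : nuclear T ->
  (forall z, J z = T -> c <= tensor_cost z) -> c <= nuclear_norm T.
Proof.
move=> [z zT] cz; apply: lb_le_inf; last first.
  by move=> _ [z' /= [_ _ z'T] <-]; exact: cz.
have [bl br] := tensor_normalize_bounded z.
exists (tensor_cost (tensor_normalize z)), (tensor_normalize z) => //=.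
by split=> //; rewrite J_normalize.
Qed.

Lemma nuclear_norm_ge0 T : nuclear T -> 0 <= nuclear_norm T.
Proof. by move=> nT; apply: le_nuclear_norm => // z _; exact: tensor_cost_ge0. Qed.

Lemma J_addE z1 z2 S T :
  J z1 = S -> J z2 = T -> J (tensor_add z1 z2) = (S + T : 'L(X, Y)).
Proof. by move=> zS zT; apply/funext => x; rewrite J_add zS zT. Qed.

Lemma J_scaleE a z T : J z = T -> J (tensor_scale a z) = (a *: T : 'L(X, Y)).
Proof. by move=> zT; apply/funext => x; rewrite J_scale zT. Qed.

Lemma J_shiftE N z T : J z = T -> J (tensor_shift N z) =
  (T - series (fun n => rank_one (tleft z n) (tright z n)) N : 'L(X, Y)).
Proof. by move=> zT; apply/funext => x; rewrite J_shift zT. Qed.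

Lemma nuclear_rank_one f y : nuclear (rank_one f y).
Proof. by exists (tensor_single f y); exact: J_single. Qed.

Lemma nuclearD S T : nuclear S -> nuclear T -> nuclear (S + T).
Proof. by move=> [z1 zS] [z2 zT]; exists (tensor_add z1 z2); exact: J_addE. Qed.

Lemma nuclearZ a T : nuclear T -> nuclear (a *: T).
Proof. by move=> [z zT]; exists (tensor_scale a z); exact: J_scaleE. Qed.

Lemma nuclearB S T : nuclear S -> nuclear T -> nuclear (S - T).
Proof. by move=> nS nT; apply: nuclearD => //; rewrite -scaleN1r; exact: nuclearZ. Qed.

Lemma nuclear0 : nuclear (0 : 'L(X, Y)).
Proof.
rewrite -(scale0r (rank_one 0 0)).
by apply: nuclearZ; exact: nuclear_rank_one.
Qed.

Lemma nuclear_series (S_ : nat -> 'L(X, Y)) N :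
  (forall n, nuclear (S_ n)) -> nuclear (series S_ N).
Proof.
move=> nS; elim: N => [|N IHN]; first by rewrite seriesEnat/= big_geq//; exact: nuclear0.
by rewrite seriesSr; exact: nuclearD.
Qed.

Lemma nuclear_normD S T : nuclear S -> nuclear T ->
  nuclear_norm (S + T) <= nuclear_norm S + nuclear_norm T.
Proof.
move=> nS nT; rewrite -lerBlDr; apply: le_nuclear_norm => // z1 zS.
rewrite lerBlDr -lerBlDl; apply: le_nuclear_norm => // z2 zT.
by rewrite lerBlDl -tensor_cost_add; apply: nuclear_norm_le; exact: J_addE.
Qed.

Let nuclear_normZ_le a T : nuclear T ->
  nuclear_norm (a *: T) <= real_part `|a| * nuclear_norm T.
Proof.
move=> nT; have [->|a0] := eqVneq a 0.
  rewrite scale0r normr0 -(of_real0 _ k) of_realK mul0r.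
  have <- : tensor_cost (tensor_single (0 : dual X) (0 : Y)) = 0.
    by rewrite tensor_cost_single rnorm0 mul0r.
  apply: nuclear_norm_le; rewrite J_single; apply/funext => x.
  exact: scaler0.
have a'0 : 0 < real_part `|a| by exact: (@rnorm_gt0 _ _ (K^o)).
rewrite -ler_pdivrMl//; apply: le_nuclear_norm => // z zT; rewrite ler_pdivrMl//.
by rewrite -tensor_cost_scale; apply: nuclear_norm_le; exact: J_scaleE.
Qed.

Lemma nuclear_normZ a T : nuclear T ->
  nuclear_norm (a *: T) = real_part `|a| * nuclear_norm T.
Proof.
move=> nT; apply/le_anti; rewrite nuclear_normZ_le//=.
have [->|a0] := eqVneq a 0.
  by rewrite normr0 -(of_real0 _ k) of_realK mul0r nuclear_norm_ge0//; exact: nuclearZ.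
have a'0 : 0 < real_part `|a| by exact: (@rnorm_gt0 _ _ (K^o)).
rewrite -ler_pdivlMl//.
have := nuclear_normZ_le a^-1 (nuclearZ a nT).
rewrite scalerA mulVf// scale1r; congr (_ <= _ * _).
apply: (can_inj (of_realK k)).
by rewrite of_realV !of_real_ge0// normfV.
Qed.

Lemma nuclear_norm_rank_one f y : nuclear_norm (rank_one f y) <= rnorm f * rnorm y.
Proof. by rewrite -tensor_cost_single; apply: nuclear_norm_le; exact: J_single. Qed.

Lemma rnorm_le_nuclear_norm T x : nuclear T -> rnorm (T x) <= rnorm x * nuclear_norm T.
Proof.
move=> nT; have [->|x0] := eqVneq x 0; first by rewrite linear0 !rnorm0 mul0r.
have nx0 := rnorm_gt0 x0.
rewrite -ler_pdivrMl//; apply: le_nuclear_norm => // z zT; rewrite ler_pdivrMl//.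
by rewrite -zT; exact: rnorm_J_le.
Qed.

Lemma nuclear_norm_eq0 T : nuclear T -> nuclear_norm T = 0 -> T = 0.
Proof.
move=> nT T0; apply/val_inj/funext => x; apply: rnorm_ler0.
by have := rnorm_le_nuclear_norm x nT; rewrite T0 mulr0.
Qed.

Lemma nuclear_norm0 : nuclear_norm (0 : 'L(X, Y)) = 0.
Proof.
rewrite -(scale0r (0 : 'L(X, Y))) nuclear_normZ; last exact: nuclear0.
by rewrite normr0 -(of_real0 _ k) of_realK mul0r.
Qed.

(** The tails of a tensor series have small cost. *)
Lemma nuclear_cvg_partial_sums z T : J z = T ->
  nuclear_cvg (series (fun n => rank_one (tleft z n) (tright z n))) T.
Proof.
move=> zT; have nT : nuclear T by exists z.
apply: (@squeeze_cvgr _ _ _ _ (cst 0) (fun N => tensor_cost (tensor_shift N z))).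
- near=> N; apply/andP; split; last by apply: nuclear_norm_le; exact: J_shiftE.
  apply: nuclear_norm_ge0; apply: nuclearB => //; apply: nuclear_series => n.
  exact: nuclear_rank_one.
- exact: cvg_cst.
under eq_fun do rewrite tensor_cost_shift.
rewrite -(subrr (tensor_cost z)); apply: cvgB; first exact: cvg_cst.
exact: tensor_cost_cvg.
Unshelve. all: by end_near. Qed.

End NuclearNorm.

(** * The functional on nuclear operators defined by an element of the annihilator *)

Section Pairing.
Variables (R : realType) (k : scalar_kind).
Local Notation K := (scalars R k).
Variables X Y : completeNormedModType K.
Implicit Types (z : tensor_series X Y) (S T : 'L(X, Y)) (f : dual X) (y : Y).
Variable G : 'L(dual X, dual Y).

Let term f y : K^o := G f y.

Let term_bounded f y : rnorm (term f y) <= rnorm G * (rnorm f * rnorm y).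
Proof.
apply: le_trans (rnorm_operator_le _ _) _.
by rewrite mulrA ler_wpM2r ?rnorm_ge0//; exact: rnorm_operator_le.
Qed.

Let term_Zl a f y : term (a *: f) y = a *: term f y.
Proof. by rewrite /term linearZ. Qed.

Lemma pairing_add z1 z2 : pairing G (tensor_add z1 z2) = pairing G z1 + pairing G z2.
Proof. exact: (tensor_sum_add (@abs_complete_scalars R k) term_bounded). Qed.

Lemma pairing_scale a z : pairing G (tensor_scale a z) = a * pairing G z.
Proof. exact: (tensor_sum_scale (@abs_complete_scalars R k) term_bounded term_Zl). Qed.

Lemma pairing_single f y : pairing G (tensor_single f y) = G f y.
Proof. exact: (tensor_sum_single term_Zl). Qed.

Lemma pairing_le z : real_part `|pairing G z| <= rnorm G * tensor_cost z.
Proof.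
exact: (tensor_sum_le (@abs_complete_scalars R k) term_bounded z (rnorm_ge0 G)).
Qed.

Hypothesis G_perp : ker_J_perp G.

(** Two series representing the same operator differ by an element of [ker J], on
    which [G] vanishes. *)
Lemma eval_nuclearE z T : J z = T -> eval_nuclear G T = pairing G z.
Proof.
move=> zT; rewrite /eval_nuclear.
have : [set pairing G z | z in [set z | J z = T]] (pairing G z) by exists z.
move=> /getI[z' /= z'T <-].
have : pairing G (tensor_add z' (tensor_scale (-1) z)) = 0.
  apply: G_perp; apply/funext => x.
  by rewrite J_add J_scale zT z'T scaleN1r subrr.
by rewrite pairing_add pairing_scale mulN1r => /subr0_eq.
Qed.

Lemma eval_nuclearD S T : nuclear S -> nuclear T ->
  eval_nuclear G (S + T) = eval_nuclear G S + eval_nuclear G T.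
Proof.
move=> [z1 zS] [z2 zT].
rewrite (eval_nuclearE (J_addE zS zT)) pairing_add.
by rewrite (eval_nuclearE zS) (eval_nuclearE zT).
Qed.

Lemma eval_nuclearZ a T : nuclear T -> eval_nuclear G (a *: T) = a * eval_nuclear G T.
Proof.
move=> [z zT]; rewrite (eval_nuclearE (J_scaleE a zT)) pairing_scale.
by rewrite (eval_nuclearE zT).
Qed.

Lemma eval_nuclear_rank_one f y : eval_nuclear G (rank_one f y) = G f y.
Proof. by rewrite (eval_nuclearE (J_single f y)) pairing_single. Qed.

Lemma eval_nuclear_le T : nuclear T ->
  real_part `|eval_nuclear G T| <= rnorm G * nuclear_norm T.
Proof.
move=> nT; have [G0|G0] := eqVneq (rnorm G) 0.
  case: nT => z zT; rewrite (eval_nuclearE zT); apply: le_trans (pairing_le z) _.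
  by rewrite G0 !mul0r.
have G'0 : 0 < rnorm G by rewrite lt_def G0 rnorm_ge0.
rewrite -ler_pdivrMl//; apply: le_nuclear_norm => // z zT; rewrite ler_pdivrMl//.
by rewrite (eval_nuclearE zT); exact: pairing_le.
Qed.

Lemma eval_nuclear_cvg (S_ : nat -> 'L(X, Y)) T :
  nuclear T -> (forall n, nuclear (S_ n)) -> nuclear_cvg S_ T ->
  eval_nuclear G (S_ n) @[n --> \oo] --> eval_nuclear G T.
Proof.
move=> nT nS ST.
apply: (@cvg_rnorm_le _ _ (K^o) _ (fun n => rnorm G * nuclear_norm (T - S_ n))).
  move=> n; apply: le_trans (eval_nuclear_le (nuclearB nT (nS n))).
  have E : eval_nuclear G T = eval_nuclear G (T - S_ n) + eval_nuclear G (S_ n).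
    by rewrite -eval_nuclearD ?subrK//; exact: nuclearB.
  by rewrite rnorm_scalar E addrK.
by rewrite -(mulr0 (rnorm G)); apply: cvgMr.
Qed.

Lemma eval_nuclear_series (a_ : nat -> K) (f_ : nat -> dual X) (y_ : nat -> Y) N :
  eval_nuclear G (series (fun n => a_ n *: rank_one (f_ n) (y_ n)) N) =
  series (fun n => a_ n * G (f_ n) (y_ n)) N.
Proof.
have nS n : nuclear (a_ n *: rank_one (f_ n) (y_ n)).
  by apply: nuclearZ; exact: nuclear_rank_one.
elim: N => [|N IHN].
  rewrite !seriesEnat/= !big_geq// -(scale0r (rank_one 0 0)) eval_nuclearZ ?mul0r//.
  exact: nuclear_rank_one.
rewrite !seriesSr eval_nuclearD ?IHN//; last exact: nuclear_series.
by rewrite eval_nuclearZ ?eval_nuclear_rank_one//; exact: nuclear_rank_one.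
Qed.

End Pairing.

(** * Norming functionals *)

Section NuclearOperatorSpace.
Variables (R : realType) (k : scalar_kind).
Local Notation K := (scalars R k).
Variables X Y : completeNormedModType K.

Definition is_nuclear : {pred 'L(X, Y)} := [pred T | `[< nuclear T >]].

Record nuclear_operator := NuclearOperator {
  nuclear_operator_val : 'L(X, Y) ;
  _ : nuclear_operator_val \in is_nuclear }.

HB.instance Definition _ := [isSub for nuclear_operator_val].
HB.instance Definition _ := [Choice of nuclear_operator by <:].

Fact is_nuclear_submod : submod_closed is_nuclear.
Proof.
split; first by apply/asboolP; exact: nuclear0.
move=> a S T /asboolP nS /asboolP nT; apply/asboolP.
by apply: nuclearD => //; exact: nuclearZ.
Qed.

HB.instance Definition _ :=
  GRing.isSubmodClosed.Build K 'L(X, Y) is_nuclear is_nuclear_submod.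
HB.instance Definition _ := [SubChoice_isSubZmodule of nuclear_operator by <:].
HB.instance Definition _ := [SubZmodule_isSubLmodule of nuclear_operator by <:].

Lemma nuclear_operatorP (S : nuclear_operator) : nuclear (val S).
Proof. by apply/asboolP; exact: (valP S). Qed.

(** The Hahn-Banach theorem in the space of nuclear operators, with the form
    extended to all operators so that [psi (rank_one f y)] makes sense as it
    stands. *)
Lemma nuclear_norming_form (T : 'L(X, Y)) : nuclear T ->
  exists psi : 'L(X, Y) -> K,
    [/\ forall a S U, nuclear S -> nuclear U ->
          psi (a *: S + U) = a * psi S + psi U,
        forall S, nuclear S -> real_part `|psi S| <= nuclear_norm S
      & psi T = of_real k (nuclear_norm T)].
Proof.
move=> nT.
pose sub S : nuclear_operator := insubd 0 S.
have subK S : nuclear S -> val (sub S) = S.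
  by move=> nS; rewrite insubdK//; apply/asboolP.
have [|a S|phi [phiL phi_le phiT]] :=
    @hahn_banach R k nuclear_operator (fun S => nuclear_norm (val S)) (sub T).
- by move=> S U; apply: nuclear_normD; exact: nuclear_operatorP.
- by apply: nuclear_normZ; exact: nuclear_operatorP.
exists (fun S => phi (sub S)); split.
- move=> a S U nS nU; rewrite -phiL; congr phi; apply/val_inj.
  rewrite [RHS]/= !subK//.
  by apply: nuclearD => //; exact: nuclearZ.
- by move=> S nS; rewrite -{2}(subK S nS) -(ler_of_real k) of_real_ge0//; exact: phi_le.
- by rewrite phiT subK.
Qed.

End NuclearOperatorSpace.

(** A form [psi] dominated by the nuclear norm is bilinear and bounded on rank one
    operators, hence given by an operator from [dual X] to [dual Y]. *)
Section FunctionalOfForm.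
Variables (R : realType) (k : scalar_kind).
Local Notation K := (scalars R k).
Variables X Y : completeNormedModType K.
Variable psi : 'L(X, Y) -> K.
Hypothesis psiL : forall a S U, nuclear S -> nuclear U ->
  psi (a *: S + U) = a * psi S + psi U.
Hypothesis psi_le : forall S, nuclear S -> real_part `|psi S| <= nuclear_norm S.

Let form (f : dual X) (y : Y) : K^o := psi (rank_one f y).

Let form_le f y : rnorm (form f y) <= rnorm f * rnorm y.
Proof.
apply: le_trans (nuclear_norm_rank_one f y).
by apply: psi_le; exact: nuclear_rank_one.
Qed.

Fact form_right_operator f : form f \in @is_operator R k Y K^o.
Proof.
apply: (is_operator_bounded (c := rnorm f)) => [a y y'|y]; last exact: form_le.
rewrite /form -psiL; try exact: nuclear_rank_one.
congr psi; apply/val_inj/funext => x /=.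
by rewrite !fctE /rank_one_fun scalerDr !scalerA mulrC.
Qed.

Fact form_left_operator :
  (fun f => Operator (form_right_operator f)) \in @is_operator R k (dual X) (dual Y).
Proof.
apply: (is_operator_bounded (c := 1)) => [a f g|f].
  apply/val_inj/funext => y; rewrite /= !fctE /form.
  rewrite -psiL; try exact: nuclear_rank_one.
  congr psi; apply/val_inj/funext => x /=.
  by rewrite !fctE /rank_one_fun /= scalerDl scalerA.
by rewrite mul1r; apply: rnorm_operator_ub; [exact: rnorm_ge0|exact: form_le].
Qed.

Definition functional_of_form : 'L(dual X, dual Y) := Operator form_left_operator.

Lemma functional_of_form_le1 : rnorm functional_of_form <= 1.
Proof.
apply: rnorm_operator_ub => // f; rewrite mul1r.
by apply: rnorm_operator_ub; [exact: rnorm_ge0|exact: form_le].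
Qed.

Let psiD S U : nuclear S -> nuclear U -> psi (S + U) = psi S + psi U.
Proof. by move=> nS nU; rewrite -[S in LHS]scale1r psiL// mul1r. Qed.

Let psi0 : psi 0 = 0.
Proof.
have := psiD (nuclear0 X Y) (nuclear0 X Y).
by rewrite addr0 -[LHS]addr0 => /addrI.
Qed.

(** Partial sums of a tensor series converge in the nuclear norm, for which
    [psi] is continuous. *)
Lemma pairing_functional_of_form (z : tensor_series X Y) (T : 'L(X, Y)) :
  J z = T -> pairing functional_of_form z = psi T.
Proof.
move=> zT; apply: cvg_lim; first exact: (@norm_hausdorff K (K^o)).
have nT : nuclear T by exists z.
pose S_ N := series (fun n => rank_one (tleft z n) (tright z n)) N.
have nS N : nuclear (S_ N).
  by apply: nuclear_series => n; exact: nuclear_rank_one.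
have psiS N : psi (S_ N) =
    series (fun n => functional_of_form (tleft z n) (tright z n)) N.
  rewrite /S_; elim: N => [|N IHN].
    by rewrite !seriesEnat/= !big_geq.
  by rewrite !seriesSr psiD ?IHN//; exact: nuclear_rank_one.
apply: (@cvg_rnorm_le _ _ (K^o) _ (fun N => nuclear_norm (T - S_ N))); last first.
  exact: nuclear_cvg_partial_sums.
move=> N; apply: le_trans (psi_le (nuclearB nT (nS N))).
rewrite rnorm_scalar -psiS -{1}(subrK (S_ N) T).
by rewrite (psiD (nuclearB nT (nS N)) (nS N)) addrK.
Qed.

Lemma functional_of_form_perp : ker_J_perp functional_of_form.
Proof. by move=> z z0; rewrite (@pairing_functional_of_form z 0) ?psi0. Qed.

End FunctionalOfForm.

(** The norm of [G] is at least 1 because [G(T)] is the nuclear norm of [T], which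
    is nonzero. *)
Lemma exists_norming_functional (R : realType) (k : scalar_kind)
    (X Y : completeNormedModType (scalars R k)) (T : 'L(X, Y)) :
  nuclear T -> T != 0 -> exists G : 'L(dual X, dual Y),
    [/\ ker_J_perp G, rnorm G = 1 &
        eval_nuclear G T = of_real k (nuclear_norm T)].
Proof.
move=> nT T0; have [psi [psiL psi_le psiT]] := nuclear_norming_form nT.
pose G := functional_of_form psiL psi_le.
have G_perp : ker_J_perp G by exact: functional_of_form_perp.
have GT : eval_nuclear G T = of_real k (nuclear_norm T).
  have [z zT] := nT; rewrite (eval_nuclearE G_perp zT).
  by rewrite (pairing_functional_of_form psiL psi_le zT).
have NT0 : 0 < nuclear_norm T.
  rewrite lt_def nuclear_norm_ge0// andbT; apply: contra_neq T0.
  exact: nuclear_norm_eq0.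
exists G; split=> //; apply/le_anti; rewrite functional_of_form_le1/=.
have := eval_nuclear_le G_perp nT.
rewrite GT normr_of_real of_realK ger0_norm ?nuclear_norm_ge0//.
by rewrite -ler_pdivrMr// divff// gt_eqF.
Qed.

(** * The equivalences *)

Lemma nneseries_realP (R : realType) (a_ : nat -> R) (l : R) :
  (forall n, 0 <= a_ n) ->
  (l%:E = \sum_(0 <= n <oo) (a_ n)%:E)%E <-> series a_ @ \oo --> l.
Proof.
move=> a0.
have sumE : (fun n => \sum_(0 <= i < n) (a_ i)%:E)%E = EFin \o series a_.
  by apply/funext => n /=; rewrite sumEFin.
rewrite sumE; split=> [lE|al]; last first.
  by apply/esym/cvg_lim => //; apply: cvg_EFin => //; exact: nearW.
have : (EFin \o series a_) @ \oo --> l%:E.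
  rewrite lE -sumE; apply: is_cvg_nneseries => n _ _.
  by rewrite lee_fin.
by move=> /fine_cvgP[_].
Qed.

Section Representation.
Variables (R : realType) (k : scalar_kind).
Variables (X Y : completeNormedModType (scalars R k)) (T : 'L(X, Y)).
Hypothesis T_nuclear : nuclear T.
Variables (lambda : nat -> R) (xs : nat -> dual X) (y : nat -> Y).
Hypothesis lambda_gt0 : forall n, 0 < lambda n.
Hypothesis xs_sphere : forall n, rnorm (xs n) = 1.
Hypothesis y_sphere : forall n, rnorm (y n) = 1.

Let S_ := series (fun n => of_real k (lambda n) *: rank_one (xs n) (y n)).
Hypothesis T_series : nuclear_cvg S_ T.

Let nuclear_partial_sum n : nuclear (S_ n).
Proof.
by apply: nuclear_series => i; apply: nuclearZ; exact: nuclear_rank_one.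
Qed.

Lemma eval_nuclear_series_cvg (G : 'L(dual X, dual Y)) : ker_J_perp G ->
  series (fun n => of_real k (lambda n) * G (xs n) (y n)) @ \oo -->
  eval_nuclear G T.
Proof.
move=> G_perp; have := eval_nuclear_cvg G_perp T_nuclear nuclear_partial_sum T_series.
by under eq_fun do rewrite eval_nuclear_series//.
Qed.

(** The [defect]s are nonnegative and sum to [N(T) - Re G(T) = 0]. *)
Lemma norming_functional_eq1 (G : 'L(dual X, dual Y)) n :
  series lambda @ \oo --> nuclear_norm T ->
  ker_J_perp G -> rnorm G = 1 ->
  eval_nuclear G T = of_real k (nuclear_norm T) -> G (xs n) (y n) = 1.
Proof.
move=> lambdaT G_perp G1 GT.
have G_le i : real_part `|G (xs i) (y i)| <= 1.
  apply: le_trans (rnorm_operator_le (G (xs i)) (y i)) _.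
  rewrite y_sphere mulr1; apply: le_trans (rnorm_operator_le G _) _.
  by rewrite G1 xs_sphere mulr1.
pose defect i := lambda i * (1 - real_part (G (xs i) (y i))).
have defect_ge0 i : 0 <= defect i.
  by rewrite mulr_ge0 ?(ltW (lambda_gt0 i))// subr_ge0 (le_trans (real_part_le_norm _)).
have defect_cvg : series defect @ \oo --> (0 : R).
  pose GS n := series (fun n => of_real k (lambda n) * G (xs n) (y n)) n.
  have -> : series defect = (fun n => series lambda n - real_part (GS n)).
    apply/funext; elim=> [|N IHN].
      by rewrite /GS !seriesEnat/= !big_geq// -(of_real0 R k) of_realK subrr.
    rewrite /GS !seriesSr real_partD real_part_of_realM IHN /defect /GS; ring.
  rewrite -(subrr (nuclear_norm T)) -[X in _ --> _ - X](of_realK k) -GT.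
  by apply: cvgB lambdaT _; apply: cvg_real_part; exact: eval_nuclear_series_cvg.
have defect0 : defect n <= 0.
  have nd : nondecreasing_seq (series defect).
    by apply: nondecreasing_series => i _ _; exact: defect_ge0.
  have := nondecreasing_cvgn_le nd (cvgP _ defect_cvg) n.+1.
  rewrite (cvg_lim (@norm_hausdorff R R^o) defect_cvg) seriesSr; apply: le_trans.
  by rewrite lerDr seriesEnat/= sumr_ge0.
have Re1 : real_part (G (xs n) (y n)) = 1.
  apply/le_anti; rewrite (le_trans (real_part_le_norm _))//= -subr_le0.
  by move: defect0; rewrite pmulr_rle0.
rewrite (@eq_of_real_norm R k (G (xs n) (y n))) Re1 ?of_real1//.
by rewrite -of_real1 -[`|_|]of_real_ge0// ler_of_real.
Qed.

(** Both [T] and its partial sums have nuclear norm at most the sum [l] of the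
    [lambda n], and [l] is the value of [G] at [T]. *)
Lemma attains_of_functional (G : 'L(dual X, dual Y)) :
  ker_J_perp G -> rnorm G = 1 -> (forall n, G (xs n) (y n) = 1) ->
  series lambda @ \oo --> nuclear_norm T.
Proof.
move=> G_perp G1 Gxy.
have := cvg_real_part (eval_nuclear_series_cvg G_perp).
rewrite (_ : (fun n => _) = series lambda); last first.
  apply/funext; elim=> [|N IHN].
    by rewrite !seriesEnat/= !big_geq// -(of_real0 R k) of_realK.
  by rewrite !seriesSr real_partD IHN real_part_of_realM Gxy -of_real1 of_realK mulr1.
set l := real_part _ => lambdal.
suff -> : nuclear_norm T = l by [].
apply/le_anti/andP; split; last first.
  apply: le_trans (real_part_le_norm _) _.
  by have := eval_nuclear_le G_perp T_nuclear; rewrite G1 mul1r.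
have lambda_le n : series lambda n <= l.
  rewrite -(cvg_lim (@norm_hausdorff R R^o) lambdal).
  apply: nondecreasing_cvgn_le; last exact: cvgP lambdal.
  by apply: nondecreasing_series => i _ _; exact: ltW.
have S_le n : nuclear_norm (S_ n) <= series lambda n.
  elim: n => [|n IHn]; first by rewrite /S_ !seriesEnat/= !big_geq// nuclear_norm0.
  rewrite /S_ !seriesSr; apply: le_trans (nuclear_normD _ _) _.
  - exact: nuclear_partial_sum.
  - by apply: nuclearZ; exact: nuclear_rank_one.
  apply: lerD => //; rewrite nuclear_normZ; last exact: nuclear_rank_one.
  rewrite normr_of_real of_realK gtr0_norm// ler_piMr ?(ltW (lambda_gt0 n))//.
  by apply: le_trans (nuclear_norm_rank_one _ _) _; rewrite xs_sphere y_sphere mulr1.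
rewrite -subr_le0; apply: (cvgr_to_ge T_series); near=> n.
have nS := nuclear_partial_sum n.
have := nuclear_normD (nuclearB T_nuclear nS) nS.
rewrite lerBlDr subrK => /le_trans; apply; rewrite lerD2l.
exact: le_trans (S_le n) (lambda_le n).
Unshelve. all: by end_near. Qed.

(** When [T = 0] every functional norms [T], so any functional of norm one in the
    annihilator will do; one that norms [rank_one (xs 0) (y 0)] is at hand. *)
Lemma exists_unit_norming_functional : exists G : 'L(dual X, dual Y),
  [/\ ker_J_perp G, rnorm G = 1 &
      eval_nuclear G T = of_real k (nuclear_norm T)].
Proof.
have [T0|] := eqVneq T 0; last exact: exists_norming_functional.
have neq0 : rank_one (xs 0%N) (y 0%N) != 0.
  apply/eqP => r0; have y0 : y 0%N != 0.
    apply/eqP => y0; have := y_sphere 0.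
    by rewrite y0 rnorm0 => /eqP; rewrite eq_sym oner_eq0.
  have x0 : xs 0%N = 0.
    apply/val_inj/funext => x.
    have /eqP := congr1 (fun S : 'L(X, Y) => S x) r0.
    by rewrite scaler_eq0 (negbTE y0) orbF => /eqP.
  by have := xs_sphere 0; rewrite x0 rnorm0 => /eqP; rewrite eq_sym oner_eq0.
have [G [G_perp G1 _]] := exists_norming_functional (nuclear_rank_one _ _) neq0.
exists G; split=> //; rewrite T0 nuclear_norm0 of_real0 -(scale0r T).
by rewrite eval_nuclearZ// mul0r.
Qed.

End Representation.

Theorem theorem3p2 (R : realType) (k : scalar_kind)
    (X Y : completeNormedModType (scalars R k))
    (T : 'L(X, Y)) (T_nuclear : nuclear T)
    (lambda : nat -> R) (xs : nat -> dual X) (y : nat -> Y)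
    (lambda_gt0 : forall n, 0 < lambda n)
    (xs_sphere : forall n, rnorm (xs n) = 1)
    (y_sphere : forall n, rnorm (y n) = 1)
    (T_series : nuclear_cvg
       (series (fun n => of_real k (lambda n) *: rank_one (xs n) (y n))) T) :
  let attains :=
    ((nuclear_norm T)%:E = \sum_(0 <= n <oo) (lambda n)%:E)%E in
  let some_functional :=
    exists G : 'L(dual X, dual Y),
      [/\ ker_J_perp G, rnorm G = 1 & forall n, G (xs n) (y n) = 1] in
  let all_norming_functionals :=
    forall G : 'L(dual X, dual Y),
      ker_J_perp G -> rnorm G = 1 ->
      eval_nuclear G T = of_real k (nuclear_norm T) ->
      forall n, G (xs n) (y n) = 1 in
  (attains <-> some_functional) /\
  (some_functional <-> all_norming_functionals).
Proof.
move=> attains some_functional all_norming_functionals.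
have attainsP : attains <-> series lambda @ \oo --> nuclear_norm T.
  by apply: nneseries_realP => n; exact: ltW.
have all_of_attains : attains -> all_norming_functionals.
  move=> /attainsP lambdaT G G_perp G1 GT n.
  exact: (norming_functional_eq1 T_nuclear lambda_gt0 xs_sphere y_sphere T_series).
have some_of_all : all_norming_functionals -> some_functional.
  have [G [G_perp G1 GT]] :=
    exists_unit_norming_functional T_nuclear xs_sphere y_sphere.
  by move=> all1; exists G; split=> //; exact: all1.
have attains_of_some : some_functional -> attains.
  move=> [G [G_perp G1 Gxy]]; apply/attainsP.
  exact: (attains_of_functional T_nuclear lambda_gt0 xs_sphere y_sphere
    T_series G_perp).
by tauto.
Qed.
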